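(* Let $\mathfrak{g}$ be a nilpotent Lie algebra over a finite field $\mathbb{F}\neq\mathbb{F}_2$, and let $n$ be a non-negative integer such that $\dim[\mathfrak{g},\mathfrak{g}] > n(n-1)/2$. Then the set $\{x\in\mathfrak{g} : b(x)\ge n\}$ of elements of breadth at least $n$ cannot be covered by $|\mathbb{F}|-1$ proper Lie subalgebras of $\mathfrak{g}$ (i.e. it is not contained in the union of any $|\mathbb{F}|-1$ proper subalgebras).
   Context: For an element $x$ of a Lie algebra $\mathfrak{g}$ over a field, the centralizer is $C_{\mathfrak{g}}(x)=\{y\in\mathfrak{g} : [x,y]=0\}$, and the breadth of $x$ is $b(x)=\dim\mathfrak{g}-\dim C_{\mathfrak{g}}(x)$, i.e. the codimension of $C_{\mathfrak{g}}(x)$ in $\mathfrak{g}$ (a non-negative integer or $\infty$). $\mathfrak{g}'=[\mathfrak{g},\mathfrak{g}]$ denotes the derived subalgebra. *)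

(* Defs.v *)
From HB Require Import structures.
From mathcomp Require Import all_boot all_order all_algebra.
Set Implicit Arguments. Unset Strict Implicit. Unset Printing Implicit Defensive.
Import GRing.Theory.
Local Open Scope ring_scope.

Section Lie.
Variables (F : fieldType) (V : lmodType F) (br : V -> V -> V).

Definition is_lie : Prop :=
  [/\ (forall (a : F) (x y z : V), br (a *: x + y) z = a *: br x z + br y z),
      (forall (a : F) (x y z : V), br z (a *: x + y) = a *: br z x + br z y),
      (forall x : V, br x x = 0) &
      (forall x y z : V, br x (br y z) + br y (br z x) + br z (br x y) = 0)].

Inductive span (S : V -> Prop) : V -> Prop :=
  | span_zero : span S 0
  | span_in x : S x -> span S x
  | span_add x y : span S x -> span S y -> span S (x + y)
  | span_scale (a : F) x : span S x -> span S (a *: x).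

Definition derived : V -> Prop := span (fun z => exists x y, z = br x y).

Fixpoint lcs (k : nat) : V -> Prop :=
  match k with
  | 0%N => fun _ => True
  | k'.+1 => span (fun z => exists x y, lcs k' y /\ z = br x y)
  end.

Definition nilpotent : Prop := exists c : nat, forall x, lcs c x -> x = 0.

Definition dim_gt (S : V -> Prop) (N : nat) : Prop :=
  exists v : 'I_N.+1 -> V, (forall i, S (v i)) /\
    forall c : 'I_N.+1 -> F, \sum_i c i *: v i = 0 -> forall i, c i = 0.

Definition centralizer (x : V) : V -> Prop := fun y => br x y = 0.

(* b(x) >= n : codimension of C(x) in g is at least n, i.e. there are n
   vectors linearly independent modulo C(x). *)
Definition breadth_ge (x : V) (n : nat) : Prop :=
  exists y : 'I_n -> V,
    forall c : 'I_n -> F, centralizer x (\sum_i c i *: y i) -> forall i, c i = 0.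

Definition subalgebra (H : V -> Prop) : Prop :=
  [/\ H 0, (forall x y, H x -> H y -> H (x + y)),
      (forall (a : F) x, H x -> H (a *: x)) &
      (forall x y, H x -> H y -> H (br x y))].

Definition proper_subalgebra (H : V -> Prop) : Prop :=
  subalgebra H /\ exists x, ~ H x.

End Lie.

(* Main.v *)
Require Import Defs.
From HB Require Import structures.
From mathcomp Require Import all_boot all_order all_algebra.
From mathcomp Require Import zify.
From Stdlib Require Import Classical.
Set Implicit Arguments. Unset Strict Implicit. Unset Printing Implicit Defensive.
Import GRing.Theory.
Local Open Scope ring_scope.

(** In a nilpotent Lie algebra every proper subalgebra H of L satisfies
    H + L' <> L, so it lies in a hyperplane containing L'.  Let M_0, M_1, ...
    be q - 1 such hyperplanes, q = |F|.  Pick B of codimension 2 with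
    L' <= B, contained in M_0 and M_1, and a hyperplane N = B + F u of L
    different from all the M_i; then M_0 and M_1 have the same trace B on N.  Pick y in L outside N
    and all the M_i.  If b(y) < n, then dim N' >= dim L' - (n - 1), since
    L' = N' + [y, L].  Induct on dim L: if N' = L', apply the induction
    hypothesis to N and n.  Otherwise K = {x in N | [y, x] in N'} is a proper
    subalgebra of N, and the coincidence of two traces leaves room for it among
    q - 1 subalgebras (this is where q > 2 is used).  The induction hypothesis
    for N and n - 1 gives x in N outside them with dim [x, N] >= n - 1, and
    [x, y] is not in N', so b(x) >= n.

    Infinite dimension is reduced to this case because a finitely generated
    nilpotent Lie algebra is finite-dimensional. *)

(** * Subspaces of a finite-dimensional space *)

Section Subspaces.
Variables (F : fieldType) (T : vectType F).
Implicit Types (A B L M : {vspace T}) (u v x y : T).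

Lemma dimv_add_line A v : v \notin A -> \dim (A + <[v]>) = (\dim A).+1.
Proof.
move=> vA; have v0 : v != 0 by apply: contraNneq vA => ->; rewrite mem0v.
rewrite dimv_disjoint_sum ?dim_vline ?v0 ?addn1 //.
apply/eqP; rewrite -subv0; apply/subvP => w; rewrite memv_cap => /andP[wA].
case/vlineP=> k wk; rewrite memv0 wk scaler_eq0 (negbTE v0) orbF.
by apply: contraNT vA => k0; rewrite -(scalerK k0 v) -wk memvZ.
Qed.


Lemma vspace_between A L k : (A <= L)%VS -> (\dim A <= k <= \dim L)%N ->
  exists M : {vspace T}, [/\ (A <= M)%VS, (M <= L)%VS & \dim M = k].
Proof.
move=> AL; elim: k => [|k IHk] /andP[Ak kL].
  by exists A; split=> //; apply/eqP; rewrite -leqn0.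
have [kA|Ak'] := leqP k.+1 (\dim A).
  by exists A; split=> //; apply/eqP; rewrite eqn_leq Ak.
have [|M [AM ML Mk]] := IHk; first by rewrite -ltnS Ak' ltnW.
have /subvPn[v vL vM] : ~~ (L <= M)%VS.
  by apply: contraTN kL => /dimvS; rewrite Mk -leqNgt.
exists (M + <[v]>)%VS; split.
- exact: subv_trans AM (addvSl _ _).
- by rewrite subv_add ML.
- by rewrite dimv_add_line ?Mk.
Qed.

Lemma hyperplane_addv M L y : (M <= L)%VS -> (\dim M).+1 = \dim L ->
  y \in L -> y \notin M -> L = (M + <[y]>)%VS.
Proof.
move=> ML dM yL yM; apply/esym/eqP.
by rewrite eqEdim subv_add ML -memvE yL dimv_add_line ?dM /=.
Qed.

(** If no subspace equals [P], every subspace inside [P] misses some vector of [P] and can be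
    enlarged by it, so dimensions inside [P] would exceed that of [T]. *)
Lemma vspace_of_pred (P : T -> Prop) :
    P 0 -> (forall x y, P x -> P y -> P (x + y)) ->
    (forall (a : F) x, P x -> P (a *: x)) ->
  exists A : {vspace T}, forall x, x \in A <-> P x.
Proof.
move=> P0 PD PZ; apply: NNPP => noA.
suff /(_ (\dim {:T}).+1)[A _] : forall k, exists2 A : {vspace T},
    (forall x, x \in A -> P x) & (k <= \dim A)%N.
  by rewrite ltnNge dimvS ?subvf.
elim=> [|k [A AP dA]]; first by exists 0%VS => // x; rewrite memv0 => /eqP->.
have [PA|/not_all_ex_not[x]] := classic (forall x, P x -> x \in A).
  by case: noA; exists A => x; split; [exact: AP | exact: PA].
move=> /(imply_to_and (P x))[Px /negP xA].
exists (A + <[x]>)%VS; last by rewrite dimv_add_line.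
by move=> _ /memv_addP[y /AP Py [_ /vlineP[a ->] ->]]; apply/PD/PZ.
Qed.

End Subspaces.

(** * Avoiding as many proper subspaces as the field has elements *)

Section Avoid.
Variables (F : finFieldType) (T : vectType F).
Implicit Types (L M : {vspace T}).

(** Let [x] avoid [Ms] but lie in [M], and let [y] lie outside [M]. All the vectors [y + a *: x]
    avoid [M], and each member of [Ms] contains at most one of them, since two would put [x] in it.
    With fewer than [#|F|] members in [Ms], pigeonhole leaves a good [a]. *)
Lemma vspace_avoid (Ms : seq {vspace T}) L : (size Ms <= #|F|)%N ->
  (forall M, M \in Ms -> ~~ (L <= M)%VS) ->
  exists2 x, x \in L & forall M, M \in Ms -> x \notin M.
Proof.
elim: Ms => [|M Ms IH] szMs LMs; first by exists 0; rewrite ?mem0v.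
have [|M' M'Ms|x xL xMs] := IH; first exact: ltnW.
  by rewrite LMs // inE M'Ms orbT.
have [xM|xM] := boolP (x \in M); last first.
  by exists x => // M'; rewrite inE => /predU1P[->//|/xMs].
have /subvPn[y yL yM] : ~~ (L <= M)%VS by rewrite LMs ?mem_head.
pose bad (a : F) (i : 'I_(size Ms)) := y + a *: x \in nth 0%VS Ms i.
have [/existsP[a /existsPn badN]|] := boolP [exists a, ~~ [exists i, bad a i]].
  exists (y + a *: x); first by rewrite memvD ?memvZ.
  move=> M'; rewrite inE => /predU1P[->|M'Ms].
    by rewrite rpredDr ?memvZ.
  have M'i : (index M' Ms < size Ms)%N by rewrite index_mem.
  by have := badN (Ordinal M'i); rewrite /bad nth_index.
rewrite negb_exists => /forallP all_bad.
have /fin_all_exists[f fP] : forall a, exists i, bad a i.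
  by move=> a; have := all_bad a; rewrite negbK => /existsP.
suff /leq_card : injective f.
  by rewrite card_ord => /(leq_trans szMs); rewrite ltnn.
move=> a b eq_f; apply/eqP; rewrite -subr_eq0; apply/negPn/negP => ab0.
have := xMs _ (mem_nth 0%VS (ltn_ord (f a))); rewrite -(scalerK ab0 x).
rewrite memvZ // scalerBl.
have -> : a *: x - b *: x = (y + a *: x) - (y + b *: x).
  by rewrite opprD addrACA subrr add0r.
by apply: memvB; [exact: fP | rewrite eq_f; exact: fP].
Qed.

End Avoid.

(** * Brackets of subspaces and consequences of nilpotency *)

Section Bracket.
Variables (F : fieldType) (T : vectType F) (ad : T -> 'End(T)).
Hypothesis lie_ad : is_lie (fun x y => ad x y).
Implicit Types (A B C H L M N : {vspace T}) (x y z : T).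

Lemma adDl x y z : ad (x + y) z = ad x z + ad y z.
Proof. by case: lie_ad => /(_ 1 x y z); rewrite !scale1r. Qed.

Lemma ad0l z : ad 0 z = 0.
Proof. by apply: (addrI (ad 0 z)); rewrite -adDl !addr0. Qed.

Lemma adZl a x z : ad (a *: x) z = a *: ad x z.
Proof. by case: lie_ad => /(_ a x 0 z); rewrite ad0l !addr0. Qed.

Lemma adxx x : ad x x = 0.
Proof. by case: lie_ad. Qed.

Lemma adC x y : ad x y = - ad y x.
Proof.
apply/eqP; rewrite -addr_eq0; apply/eqP.
by have := adxx (x + y); rewrite adDl !linearD /= !adxx add0r addr0.
Qed.

Lemma ad_leibniz z x y : ad z (ad x y) = ad (ad z x) y + ad x (ad z y).
Proof.
case: lie_ad => _ _ _ /(_ z x y)/eqP; rewrite -addrA addr_eq0 => /eqP->.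
by rewrite (adC (ad z x)) (adC z y) linearN opprD addrC.
Qed.

Definition brv A B : {vspace T} :=
  (\sum_(i < \dim A) (ad (vbasis A)`_i @: B))%VS.

Lemma mem_brv A B x y : x \in A -> y \in B -> ad x y \in brv A B.
Proof.
move=> xA yB; rewrite {1}(coord_vbasis xA).
rewrite (big_morph (fun x => ad x y) (fun _ _ => adDl _ _ _) (ad0l y)).
apply: memv_suml => i _; rewrite adZl memvZ //.
by apply: (subvP (sumv_sup i _ (subvv _))); rewrite ?memv_img.
Qed.

Lemma brv_ind A B (P : T -> Prop) :
    P 0 -> (forall x y, P x -> P y -> P (x + y)) ->
    (forall x y, x \in A -> y \in B -> P (ad x y)) ->
  forall z, z \in brv A B -> P z.
Proof.
move=> P0 PD Pad z /memv_sumP[f fad ->]; apply: (big_ind P) => // i _.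
have /memv_imgP[y yB ->] := fad i isT; apply: Pad => //.
by apply/vbasis_mem/mem_nth; rewrite size_tuple.
Qed.

Lemma brv_subP A B C :
  (forall x y, x \in A -> y \in B -> ad x y \in C) -> (brv A B <= C)%VS.
Proof.
move=> brC; apply/subvP; apply: brv_ind; [exact: mem0v|exact: memvD|exact: brC].
Qed.

Lemma brvS A B : (A <= B)%VS -> (brv A A <= brv B B)%VS.
Proof.
by move=> /subvP AB; apply: brv_subP => x y /AB ? /AB ?; apply: mem_brv.
Qed.

Definition lie_closed A : bool := (brv A A <= A)%VS.

Lemma lie_closed_mem A x y : lie_closed A -> x \in A -> y \in A -> ad x y \in A.
Proof. by move=> /subvP cA xA yA; apply/cA/mem_brv. Qed.

Lemma brv_line y : brv <[y]> <[y]> = 0%VS.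
Proof.
apply/eqP; rewrite -subv0; apply: brv_subP => _ _ /vlineP[a ->] /vlineP[b ->].
by rewrite adZl linearZ /= adxx !scaler0 mem0v.
Qed.

Lemma brv_add_line N y C : (brv N N <= C)%VS ->
  (forall a, a \in N -> ad y a \in C) ->
  (brv (N + <[y]>) (N + <[y]>) <= C)%VS.
Proof.
move=> /subvP NC yC; apply: brv_subP => x z.
move=> /memv_addP[a aN [_ /vlineP[k ->] ->]].
move=> /memv_addP[b bN [_ /vlineP[l ->] ->]].
rewrite adDl !linearD !linearZ /= !adZl adxx (adC a y) !scaler0 addr0.
by rewrite !memvD ?memvZ ?memvN ?yC //; apply/NC/mem_brv.
Qed.

(** Nilpotency is recorded once, by a descending chain of the ambient space. It then serves every
    subalgebra [L], so an induction on [L] need not reprove it. *)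
Variables (D : nat -> {vspace T}) (c : nat).
Hypotheses (D0 : D 0 = fullv) (Dc : D c = 0%VS).
Hypothesis DS : forall k x y, y \in D k -> ad x y \in D k.+1.

(** If each element of [L] is one of [H] plus one of [D k], expanding a bracket gives one term in
    [H] and others in [D k.+1]. So L' lies in [H + (L :&: D k.+1)], hence so does [L]; at [k = c]
    the error term vanishes. *)
Lemma lie_closed_frattini L H : lie_closed L -> lie_closed H -> (H <= L)%VS ->
  (L <= H + brv L L)%VS -> (L <= H)%VS.
Proof.
move=> cL cH HL LH; suff LD k : (L <= H + (L :&: D k))%VS.
  by have := LD c; rewrite Dc capv0 addv0.
elim: k => [|k IHk]; first by rewrite D0 capvf addvSr.
apply: subv_trans LH _; rewrite subv_add addvSl; apply: brv_subP => x y xL yL.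
have /memv_addP[h hH [d /memv_capP[dL dD] ->]] := subvP IHk x xL.
have /memv_addP[h' hH' [d' /memv_capP[dL' dD'] ->]] := subvP IHk y yL.
have hL := subvP HL h hH; have hL' := subvP HL h' hH'.
rewrite adDl [ad h _]linearD -addrA memv_add ?lie_closed_mem //=.
rewrite linearD /= (adC d h') memv_cap !memvD ?memvN //.
all: by [exact: DS | exact: lie_closed_mem].
Qed.

Lemma lie_closed_hyperplane L H : lie_closed L -> lie_closed H -> (H <= L)%VS ->
  ~~ (L <= H)%VS -> exists M : {vspace T},
  [/\ (H + brv L L <= M)%VS, (M <= L)%VS & (\dim M).+1 = \dim L].
Proof.
move=> cL cH HL LH.
have HL' : (H + brv L L <= L)%VS by rewrite subv_add HL.
have dHL : (\dim (H + brv L L) < \dim L)%N.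
  rewrite ltnNge (geq_leqif (dimv_leqif_sup HL')); apply: contra LH.
  exact: lie_closed_frattini.
have [|M [HM ML dM]] := vspace_between (k := (\dim L).-1) HL'; first by lia.
by exists M; split=> //; lia.
Qed.

(** In codimension at most 1, [L] would be a line plus L'. Lines are abelian subalgebras, so [L]
    would be that line and L' would be zero. *)
Lemma codim_brv_ge2 L : lie_closed L -> (0 < \dim (brv L L))%N ->
  (\dim (brv L L) + 2 <= \dim L)%N.
Proof.
move=> cL brL; rewrite leqNgt; apply/negP => dL.
have nLy y : y \in L -> ~~ (L <= <[y]> + brv L L)%VS.
  rewrite memvE => yL; apply: contraL brL => Ly.
  have cy : lie_closed <[y]> by rewrite /lie_closed brv_line sub0v.
  have := brvS (lie_closed_frattini cL cy yL Ly).
  by rewrite brv_line subv0 => /eqP->; rewrite dimv0.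
(* The zero vector gives that L' is not all of [L], hence a [y] outside it. *)
have /subvPn[y yL] := nLy 0 (mem0v L).
rewrite addvC => y0; have ybr : y \notin brv L L.
  by apply: contra y0; apply/subvP/addvSl.
have /negP[] := nLy y yL; have brL' : (brv L L + <[y]> <= L)%VS.
  by rewrite subv_add -memvE yL andbT.
rewrite addvC -(geq_leqif (dimv_leqif_sup brL')) dimv_add_line //.
by rewrite addn2 ltnS in dL.
Qed.

End Bracket.

(** * The finite-dimensional theorem, by induction on dimension *)

Section FiniteDimensional.
Variables (F : finFieldType) (T : vectType F) (ad : T -> 'End(T)).
Hypothesis lie_ad : is_lie (fun x y => ad x y).
Variables (D : nat -> {vspace T}) (c : nat).
Hypotheses (D0 : D 0 = fullv) (Dc : D c = 0%VS).
Hypothesis DS : forall k x y, y \in D k -> ad x y \in D k.+1.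
Hypothesis F_gt2 : (2 < #|F|)%N.
Implicit Types (L M : {vspace T}).

Lemma brv_hyperplane_dim L N y : L = (N + <[y]>)%VS ->
  (\dim (brv ad L L) <= \dim (brv ad N N) + \dim (ad y @: L))%N.
Proof.
move=> defL; apply: leq_trans (dimvS _) (leq_of_leqif (dimv_add_leqif _ _)).
rewrite {1 2}defL; apply: (brv_add_line lie_ad (addvSl _ _)) => a aN.
by apply/(subvP (addvSr _ _))/memv_img; rewrite defL; apply/(subvP (addvSl _ _)).
Qed.

(** Repetitions are allowed in [Ms], so the number of subspaces to avoid is unchanged. *)
Lemma lie_closed_hyperplanes L (Hs : seq {vspace T}) : lie_closed ad L ->
  (forall H, H \in Hs -> [/\ lie_closed ad H, (H <= L)%VS & ~~ (L <= H)%VS]) ->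
  exists Ms : seq {vspace T}, [/\ size Ms = size Hs,
    forall M, M \in Ms ->
      [/\ (brv ad L L <= M)%VS, (M <= L)%VS & (\dim M).+1 = \dim L] &
    forall H, H \in Hs -> exists2 M : {vspace T}, M \in Ms & (H <= M)%VS].
Proof.
move=> cL; elim: Hs => [|H Hs IH] Hs_proper; first by exists [::].
have [|Ms [szMs Ms_hyp HsMs]] := IH.
  by move=> K KHs; apply: Hs_proper; rewrite inE KHs orbT.
have [cH HL LH] := Hs_proper H (mem_head _ _).
have [M [HM ML dM]] := lie_closed_hyperplane lie_ad D0 Dc DS cL cH HL LH.
move: HM; rewrite subv_add => /andP[HM L'M].
exists (M :: Ms); split=> [|K|K]; rewrite ?inE /=; first by rewrite szMs.
  by case/predU1P=> [->|/Ms_hyp].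
case/predU1P=> [->|/HsMs[K' K'Ms KK']]; first by exists M; rewrite ?mem_head.
by exists K'; rewrite ?inE ?K'Ms ?orbT.
Qed.

(** Passing from breadth [m.+1] to [m] lowers the bound by [m], which pays for the loss of
    [\dim (ad y @: L)] in the derived algebra. *)
Lemma triangularS m : ((m.+1 * m) %/ 2 = m * (m - 1) %/ 2 + m)%N.
Proof.
have -> : (m.+1 * m = m * 2 + m * (m - 1))%N by case: m => // m; lia.
by rewrite divnMDl // addnC.
Qed.

(** By rank-nullity, [\dim (ad x @: L)] is the breadth of [x] in [L]. Arbitrary subalgebras are
    allowed because [K] below need not be a hyperplane. *)
Theorem large_breadth_avoiding L n (Hs : seq {vspace T}) : lie_closed ad L ->
  (n * (n - 1) %/ 2 < \dim (brv ad L L))%N -> (size Hs).+1 = #|F| ->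
  (forall H, H \in Hs -> [/\ lie_closed ad H, (H <= L)%VS & ~~ (L <= H)%VS]) ->
  exists2 x, x \in L &
    (n <= \dim (ad x @: L))%N /\ forall H, H \in Hs -> x \notin H.
Proof.
have [d dL] := ubnP (\dim L).
elim: d => // d IHd in L n Hs dL *; rewrite ltnS in dL => cL dL' szHs Hs_proper.
have [Ms [szMs Ms_hyp HsMs]] := lie_closed_hyperplanes cL Hs_proper.
suff [x xL [bx xMs]] : exists2 x, x \in L &
    (n <= \dim (ad x @: L))%N /\ forall M, M \in Ms -> x \notin M.
  exists x => //; split=> // H /HsMs[M /xMs xM HM].
  by apply: contra xM; apply/subvP.
move: szMs szHs Ms_hyp => <-; clear Hs Hs_proper HsMs.
(* Since [#|F| > 2], there are at least two hyperplanes, possibly equal. *)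
case: Ms => [|M0 [|M1 Ms]] szMs Ms_hyp; try by move: F_gt2; rewrite -szMs.
have L'dim := codim_brv_ge2 lie_ad D0 Dc DS cL (leq_ltn_trans (leq0n _) dL').
have [L'M0 M0L dM0] := Ms_hyp _ (mem_head _ _).
have [L'M1 M1L dM1] :
    [/\ (brv ad L L <= M1)%VS, (M1 <= L)%VS & (\dim M1).+1 = \dim L].
  by apply: Ms_hyp; rewrite !inE eqxx orbT.
have nLM M : M \in [:: M0, M1 & Ms] -> ~~ (L <= M)%VS.
  by move=> /Ms_hyp[_ _ dM]; apply/negP => /dimvS; rewrite -dM ltnn.
have [u uL uMs] := vspace_avoid (ltnW (eq_leq szMs)) nLM.
(* L' has codimension at least 2 and [M0 :&: M1] at most 2, so [B] fits between them. *)
have [B [L'B BM01 dB]] : exists B : {vspace T},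
    [/\ (brv ad L L <= B)%VS, (B <= M0 :&: M1)%VS & \dim B = (\dim L - 2)%N].
  apply: vspace_between; first by rewrite subv_cap L'M0.
  have M01L : (M0 + M1 <= L)%VS by rewrite subv_add M0L.
  by have := dimv_sum_cap M0 M1; have := dimvS M01L; lia.
move: (BM01); rewrite subv_cap => /andP[BM0 BM1].
have uB : u \notin B by apply: contra (uMs _ (mem_head _ _)); apply/subvP.
pose N := (B + <[u]>)%VS.
have BN : (B <= N)%VS by apply: addvSl.
have uN : u \in N by apply/(subvP (addvSr _ _))/memv_line.
have dN : (\dim N).+1 = \dim L.
  rewrite dimv_add_line // dB -addn2 subnK //.
  exact: leq_trans (leq_addl _ _) L'dim.
have NL : (N <= L)%VS by rewrite subv_add -memvE uL (subv_trans BM0 M0L).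
have L'N := subv_trans L'B BN.
have N'L' := brvS lie_ad NL.
have cN : lie_closed ad N := subv_trans N'L' L'N.
(* The trace of [M] on [N] contains [B], a hyperplane of [N], and misses [u], so it is [B]. *)
have MNB M : M \in [:: M0; M1] -> (M :&: N <= B)%VS.
  move=> M01; have uM : u \notin M.
    by apply: uMs; move: M01; rewrite !inE => /orP[] ->; rewrite ?orbT.
  have BMN : (B <= M :&: N)%VS.
    by rewrite subv_cap BN andbT; move: M01; rewrite !inE => /orP[] /eqP->.
  rewrite -(geq_leqif (dimv_leqif_sup BMN)) -ltnS -(dimv_add_line uB) -/N.
  rewrite ltnNge (geq_leqif (dimv_leqif_sup (capvSr _ _))).
  by apply: contra uM => /subvP/(_ u uN); rewrite memv_cap => /andP[].
(* [N] and the [#|F| - 1] hyperplanes are exactly [#|F|] subspaces, the most that [vspace_avoid]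
   permits. *)
have [y yL yNMs] : exists2 y, y \in L &
    forall M, M \in [:: N, M0, M1 & Ms] -> y \notin M.
  apply: vspace_avoid => [|M]; first by rewrite -szMs.
  by rewrite inE => /predU1P[->|/nLM//]; apply/negP => /dimvS; rewrite -dN ltnn.
have yN := yNMs N (mem_head _ _).
have yMs M : M \in [:: M0, M1 & Ms] -> y \notin M.
  by move=> MMs; apply: yNMs; rewrite inE MMs orbT.
have [by_ge|by_lt] := leqP n (\dim (ad y @: L)); first by exists y.
case: n => // m in dL' by_lt *; rewrite ltnS in by_lt.
have defL := hyperplane_addv NL dN yL yN.
have N_proper M : M \in [:: M0, M1 & Ms] ->
    [/\ lie_closed ad (M :&: N), (M :&: N <= N)%VS & ~~ (N <= M :&: N)%VS].
  move=> MMs; have [L'M _ _] := Ms_hyp M MMs.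
  split; rewrite ?capvSr //.
    apply: subv_trans (brvS lie_ad (subv_trans (capvSr M N) NL)) _.
    by rewrite subv_cap L'M.
  by apply: contra (uMs M MMs) => /subvP/(_ u uN); rewrite memv_cap => /andP[].
have dNd : (\dim N < d)%N by rewrite dN.
have ad_le x : (\dim (ad x @: N) <= \dim (ad x @: L))%N by apply/dimvS/limgS.
have [L'N'|L'N'] := boolP (brv ad L L <= brv ad N N)%VS.
  have [|||||x xN [bx xMN]] := IHd N m.+1 [seq M :&: N | M <- [:: M0, M1 & Ms]]%VS.
  - by [].
  - by [].
  - exact: leq_trans dL' (dimvS L'N').
  - by rewrite size_map.
  - by move=> _ /mapP[M MMs ->]; apply: N_proper.
  exists x; first exact: (subvP NL); split; first exact: leq_trans bx _.
  move=> M MMs; have := xMN _ (map_f _ MMs).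
  by rewrite memv_cap xN andbT.
(* [K] is closed by the Leibniz rule. If it were [N], then [ad y] would map [N] into N', forcing L'
   into N'. *)
pose K := (N :&: (ad y @^-1: brv ad N N))%VS.
have KP x : x \in K = (x \in N) && (ad y x \in brv ad N N).
  by rewrite memv_cap memv_preim.
have N'N := subvP cN.
have K_proper : [/\ lie_closed ad K, (K <= N)%VS & ~~ (N <= K)%VS].
  split; rewrite ?capvSl //.
    apply: brv_subP => // a b; rewrite !KP => /andP[aN ya] /andP[bN yb].
    rewrite lie_closed_mem // ad_leibniz // memvD //; apply: mem_brv => //; exact: N'N.
  apply: contra L'N' => /subvP NK; rewrite {1 2}defL.
  by apply: brv_add_line => // a /NK; rewrite KP => /andP[].
(* [B] stands for the traces of both [M0] and [M1], which frees the place taken by [K]. *)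
have [|||||x xN [bx xKs]] := IHd N m [:: B, K & [seq M :&: N | M <- Ms]]%VS.
- by [].
- by [].
- have := leq_trans dL' (brv_hyperplane_dim defL).
  rewrite subn1 triangularS => lt; rewrite -(ltn_add2r m).
  by apply: leq_trans lt _; rewrite leq_add2l.
- by rewrite /= size_map.
- move=> H; rewrite !inE => /or3P[/eqP->|/eqP->//|/mapP[M MMs ->]].
    split=> //; first exact: subv_trans (brvS lie_ad (subv_trans BM0 M0L)) L'B.
    by apply: contra uB => /subvP/(_ u uN).
  by apply: N_proper; rewrite !inE MMs !orbT.
have xB : x \notin B by apply: xKs; rewrite mem_head.
have /negP : x \notin K by apply: xKs; rewrite !inE eqxx orbT.
rewrite KP xN /= => yx; exists x; first exact: (subvP NL); split.
  (* The image of [N] under [ad x] lies in N' while [ad x y] does not, so the image of [L] is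
     strictly larger. *)
  apply: leq_ltn_trans bx _; rewrite ltnNge.
  rewrite (geq_leqif (dimv_leqif_sup (limgS _ NL))).
  apply/negP => /subvP/(_ (ad x y) (memv_img _ yL)) /memv_imgP[z zN xyz].
  by case: yx; rewrite adC // xyz memvN mem_brv.
move=> M; rewrite !inE => MMs; apply/negP => xM.
have xMN : x \in (M :&: N)%VS by rewrite memv_cap xM.
have M01 : M \in [:: M0; M1] -> False.
  by move=> /MNB/subvP/(_ x xMN); apply/negP.
case/or3P: MMs => [M_0|M_1|MMs].
- by apply: M01; rewrite !inE M_0.
- by apply: M01; rewrite !inE M_1 orbT.
have /negP[] // : x \notin (M :&: N)%VS.
by apply: xKs; rewrite !inE (map_f (fun M' => M' :&: N)%VS) ?orbT.
Qed.

End FiniteDimensional.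

(** * Finitely generated nilpotent Lie algebras are finite-dimensional *)

Section FinitelyGenerated.
Variables (F : finFieldType) (V : lmodType F).
Implicit Types (x y z : V) (s G : seq V).

Lemma span_sum (S : V -> Prop) (I : Type) (r : seq I) (f : I -> V) :
  (forall i, Defs.span S (f i)) -> Defs.span S (\sum_(i <- r) f i).
Proof.
move=> fS; apply: (big_ind (Defs.span S)) => //.
- exact: span_zero.
- exact: span_add.
Qed.

(** The model is a complement of the kernel of the map sending coefficient rows to combinations of
    [G]. *)
Lemma finite_span_model G : exists (T : vectType F) (psi : {linear T -> V}),
  injective psi /\
  forall z, Defs.span (fun x => x \in G) z <-> exists u, psi u = z.
Proof.
pose phi (u : 'rV[F]_(size G)) := \sum_i u 0 i *: nth 0 G i.
have phi_lin : linear phi.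
  move=> a u v; rewrite /phi scaler_sumr -big_split; apply: eq_bigr => i _ /=.
  by rewrite !mxE scalerDl scalerA.
pose phiL : {linear 'rV[F]_(size G) -> V} :=
  HB.pack phi (GRing.isLinear.Build _ _ _ _ phi phi_lin).
(* As [F] is finite, the kernel is a finite set and can be spanned by its enumeration. *)
pose kphi : {vspace 'rV[F]_(size G)} := <<enum [pred u | phiL u == 0%R]>>%VS.
have kphiP u : (u \in kphi) = (phiL u == 0).
  apply/idP/idP => [/coord_span->|u0]; last by rewrite memv_span // mem_enum.
  rewrite linear_sum big1 // => i _; rewrite linearZ /=.
  have : (enum [pred u | phiL u == 0])`_i \in enum [pred u | phiL u == 0].
    by rewrite mem_nth // -cardE.
  by rewrite mem_enum inE => /eqP /= ->; rewrite scaler0.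
pose psi : {linear subvs_of kphi^C%VS -> V} := (phiL \o vsval)%FUN.
exists (subvs_of kphi^C%VS), psi; split=> [u v /= uv|z].
  apply/val_inj/eqP; rewrite -subr_eq0 -memv0 -(capv_compl kphi) memv_cap.
  by rewrite kphiP linearB /= uv subrr eqxx memvB ?subvsP.
split=> [|[u <-]]; last first.
  by rewrite /=; apply: span_sum => i; apply/span_scale/span_in/mem_nth.
have surj u : exists v : subvs_of kphi^C%VS, phiL (vsval v) = phiL u.
  have : u \in (kphi + kphi^C)%VS by rewrite addv_complf memvf.
  case/memv_addP=> k; rewrite kphiP => /eqP k0 [w wC ->].
  by exists (Subvs wC); rewrite linearD k0 add0r.
elim=> [|x xG|x y _ [u <-] _ [v <-]|a x _ [u <-]].
- by exists 0; rewrite !linear0.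
- have xi : (index x G < size G)%N by rewrite index_mem.
  have [v vx] := surj (delta_mx 0 (Ordinal xi)); exists v.
  rewrite -[LHS]/(phiL (vsval v)) vx /= /phi.
  rewrite (bigD1 (Ordinal xi)) //= mxE !eqxx scale1r nth_index // big1 ?addr0 //.
  by move=> j ji; rewrite mxE (negbTE ji) andbF scale0r.
- by exists (u + v); rewrite !linearD.
- by exists (a *: u); rewrite !linearZ.
Qed.

Variable br : V -> V -> V.
Hypothesis lie_br : is_lie br.

Lemma brDl x y z : br (x + y) z = br x z + br y z.
Proof. by case: lie_br => /(_ 1 x y z); rewrite !scale1r. Qed.

Lemma brDr x y z : br z (x + y) = br z x + br z y.
Proof. by case: lie_br => _ /(_ 1 x y z); rewrite !scale1r. Qed.

Lemma br0l z : br 0 z = 0.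
Proof. by apply: (addrI (br 0 z)); rewrite -brDl !addr0. Qed.

Lemma br0r z : br z 0 = 0.
Proof. by apply: (addrI (br z 0)); rewrite -brDr !addr0. Qed.

Lemma brZl a x z : br (a *: x) z = a *: br x z.
Proof. by case: lie_br => /(_ a x 0 z); rewrite br0l !addr0. Qed.

Lemma brZr a x z : br z (a *: x) = a *: br z x.
Proof. by case: lie_br => _ /(_ a x 0 z); rewrite br0r !addr0. Qed.

Lemma brNr x z : br z (- x) = - br z x.
Proof. by rewrite -scaleN1r brZr scaleN1r. Qed.

Lemma brC x y : br x y = - br y x.
Proof.
case: lie_br => _ _ brxx _; apply/eqP; rewrite -addr_eq0; apply/eqP.
by have := brxx (x + y); rewrite brDl !brDr !brxx add0r addr0.
Qed.

Lemma br_assoc x y z : br (br x y) z = br x (br y z) - br y (br x z).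
Proof.
case: lie_br => _ _ _ /(_ x y z) /eqP; rewrite addr_eq0 => /eqP jac.
by rewrite (brC (br x y)) -jac (brC x z) brNr opprK.
Qed.

Lemma span_br (S : V -> Prop) (P : V -> Prop) :
  (forall x y, P x -> S y -> Defs.span S (br x y)) ->
  forall x y, P x -> Defs.span S y -> Defs.span S (br x y).
Proof.
move=> SP x y Px; elim=> [|z Sz|z w _ IHz _ IHw|a z _ IHz].
- by rewrite br0r; apply: span_zero.
- exact: SP.
- by rewrite brDr; apply: span_add.
- by rewrite brZr; apply: span_scale.
Qed.

(** These are the right-normed words of length [k.+1]; the shift matches [lcs], whose term 0 is
    everything. *)
Fixpoint iterated_brackets s k : seq V :=
  if k is k'.+1 then [seq br x y | x <- s, y <- iterated_brackets s k'] else s.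

Lemma iterated_brackets_lcs s k w : w \in iterated_brackets s k -> lcs br k w.
Proof.
elim: k w => // k IHk w /= /allpairsP[[x y] /= [_ /IHk yk ->]].
by apply: span_in; exists x, y.
Qed.

(** [G] collects the right-normed words of levels 0 to [c]. Its span is stable under bracketing with
    a letter, as words of level [c] vanish. Jacobi extends this to bracketing with a word, by
    induction on its level, and linearity to the whole span. *)
Lemma finite_span_closed s : nilpotent br -> exists G,
  {subset s <= G} /\ forall x y, Defs.span (fun z => z \in G) x ->
    Defs.span (fun z => z \in G) y -> Defs.span (fun z => z \in G) (br x y).
Proof.
move=> [c nil_c]; pose G := flatten (mkseq (iterated_brackets s) c.+1).
pose E := Defs.span (fun z => z \in G).
have wordG k w : w \in iterated_brackets s k -> (k <= c)%N -> w \in G.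
  move=> wk kc; apply/flattenP; exists (iterated_brackets s k) => //.
  by apply/map_f; rewrite mem_iota.
have GP w : w \in G -> exists2 k, (k <= c)%N & w \in iterated_brackets s k.
  by case/flattenP=> _ /mapP[k + ->]; rewrite mem_iota; exists k.
have Es : forall x y, x \in s -> E y -> E (br x y).
  apply: span_br => x y xs /GP[k kc yk].
  have [ck|kc'] := leqP c k.
    have yc : y \in iterated_brackets s c by rewrite (@anti_leq c k) ?ck.
    by rewrite (nil_c _ (iterated_brackets_lcs yc)) br0r; apply: span_zero.
  by apply/span_in/(wordG k.+1) => //; apply: allpairs_f.
have EG k w z : w \in iterated_brackets s k -> E z -> E (br w z).
  elim: k w z => [|k IHk] w z /=; first exact: Es.
  case/allpairsP=> [[x y] /= [xs yk ->]] Ez; rewrite br_assoc.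
  apply: span_add; first by apply/Es => //; apply: IHk.
  by rewrite -scaleN1r; apply/span_scale/IHk => //; apply: Es.
exists G; split=> [x xs|x y Ex Ey]; first exact: (wordG 0).
rewrite brC -scaleN1r; apply: span_scale.
apply: (span_br (P := E)) Ey Ex => {}y {}x Ey /GP[k _ xk].
by rewrite brC -scaleN1r; apply/span_scale/(EG k).
Qed.

Lemma finite_dim_model s : nilpotent br ->
  exists (T : vectType F) (psi : {linear T -> V}) (ad : T -> 'End(T)),
  [/\ injective psi, forall u v, psi (ad u v) = br (psi u) (psi v) &
      forall x, x \in s -> exists u, psi u = x].
Proof.
move=> /(finite_span_closed s)[G [sG brG]].
have [T [psi [psi_inj psiP]]] := finite_span_model G.
have adE u v : exists w, psi w == br (psi u) (psi v).
  have [|w <-] := (psiP (br (psi u) (psi v))).1; last by exists w.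
  by apply: brG; apply/psiP; [exists u|exists v].
(* The chosen preimage is unique because [psi] is injective; this makes [b u] linear. *)
pose b u v := xchoose (adE u v).
have bP u v : psi (b u v) = br (psi u) (psi v) by apply/eqP/(xchooseP (adE u v)).
have lin_b u : linear (b u).
  by move=> a v w; apply: psi_inj; rewrite linearP !bP linearP brDr brZr.
pose bL u : {linear T -> T} :=
  HB.pack (b u) (GRing.isLinear.Build _ _ _ _ (b u) (lin_b u)).
exists T, psi, (fun u => linfun (bL u)); split=> // [u v|x xs].
  by rewrite lfunE bP.
by apply/psiP/span_in/sG.
Qed.

(** Scalars are absorbed into the left entries, leaving finitely many vectors to use as
    generators. *)
Lemma derived_sum z : derived br z ->
  exists s : seq (V * V), z = \sum_(p <- s) br p.1 p.2.
Proof.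
elim=> [|_ [x [y ->]]|x y _ [s ->] _ [t ->]|a x _ [s ->]].
- by exists [::]; rewrite big_nil.
- by exists [:: (x, y)]; rewrite big_seq1.
- by exists (s ++ t); rewrite big_cat.
- exists [seq (a *: p.1, p.2) | p <- s]; rewrite big_map scaler_sumr.
  by apply: eq_bigr => p _; rewrite brZl.
Qed.

End FinitelyGenerated.

(** * Transfer between a finite-dimensional model and the Lie algebra *)

Section Model.
Variables (F : finFieldType) (V : lmodType F) (br : V -> V -> V).
Hypothesis lie_br : is_lie br.
Variables (T : vectType F) (psi : {linear T -> V}) (ad : T -> 'End(T)).
Hypothesis psi_inj : injective psi.
Hypothesis psi_ad : forall u v, psi (ad u v) = br (psi u) (psi v).

Lemma model_is_lie : is_lie (fun u v => ad u v).
Proof.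
case: lie_br => brl brr brxx jac; split=> [a u v w|a u v w|u|u v w]; apply: psi_inj.
- by rewrite linearP !psi_ad linearP brl.
- by rewrite !linearP.
- by rewrite psi_ad brxx linear0.
- by rewrite !linearD !psi_ad jac linear0.
Qed.

Fixpoint lower_central k : {vspace T} :=
  if k is k'.+1 then brv ad fullv (lower_central k') else fullv.

Lemma lower_central_lcs k u : u \in lower_central k -> lcs br k (psi u).
Proof.
elim: k u => //= k IHk; apply: brv_ind => [|u v|u v _ vk].
- by rewrite linear0; apply: span_zero.
- by rewrite linearD; apply: span_add.
- by apply: span_in; exists (psi u), (psi v); split; [exact: IHk|].
Qed.

Lemma model_derived (s : seq (V * V)) :
  (forall p, p \in s -> (exists u, psi u = p.1) /\ exists u, psi u = p.2) ->
  exists2 u, u \in brv ad fullv fullv & psi u = \sum_(p <- s) br p.1 p.2.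
Proof.
elim: s => [|p s IHs] sP; first by exists 0; rewrite ?mem0v ?big_nil ?linear0.
have [q qs|u uL us] := IHs; first by apply: sP; rewrite inE qs orbT.
have [[v vp] [w wp]] := sP p (mem_head _ _).
exists (ad v w + u); first by rewrite memvD ?mem_brv ?memvf //; apply: model_is_lie.
by rewrite big_cons linearD psi_ad vp wp us.
Qed.

Lemma model_dim (A : {vspace T}) N (u : 'I_N -> T) : (forall i, u i \in A) ->
  (forall a : 'I_N -> F, \sum_i a i *: psi (u i) = 0 -> forall i, a i = 0) ->
  (N <= \dim A)%N.
Proof.
move=> uA u_free; pose X := [tuple u i | i < N].
have Xi (i : 'I_N) : X`_i = u i by rewrite -tnth_nth tnth_mktuple.
have /eqP <- : \dim <<X>> == N.
  rewrite -[X in _ == X](size_tuple X) -/(free X); apply/freeP => a aX.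
  apply: u_free; rewrite -[RHS](linear0 psi) -aX linear_sum.
  by apply: eq_bigr => i _; rewrite linearZ Xi.
by apply/dimvS/span_subvP => _ /mapP[i _ ->].
Qed.

(** Preimages under [ad u] of [n] independent vectors of its image are independent modulo the
    centralizer. Breadth can only grow from the model to [V]. *)
Lemma model_breadth u n : (n <= \dim (ad u @: fullv))%N -> breadth_ge br (psi u) n.
Proof.
set U := (_ @: _)%VS => nU; pose X := take n (vbasis U).
have szX : size X == n by rewrite size_take_min size_tuple (minn_idPl nU).
have /freeP freeX : free (Tuple szX).
  apply: (@catl_free _ _ (drop n (vbasis U))).
  by rewrite cat_take_drop (basis_free (vbasisP U)).
exists (fun i => psi ((ad u)^-1%VF X`_i)) => a.
rewrite /centralizer => a0; apply: freeX.
apply: psi_inj; rewrite linear0 -[RHS]a0.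
have -> : \sum_i a i *: psi ((ad u)^-1%VF X`_i) =
          psi (\sum_i a i *: (ad u)^-1%VF X`_i).
  by rewrite linear_sum; apply: eq_bigr => i _; rewrite linearZ.
rewrite -psi_ad [ad u _]linear_sum; congr (psi _); apply: eq_bigr => i _.
rewrite linearZ /= limg_lfunVK //; apply/vbasis_mem/mem_take/mem_nth.
by rewrite (eqP szX).
Qed.

End Model.

(** * Reduction of the general case to finite dimension *)

Theorem theorem1p2 (F : finFieldType) (V : lmodType F) (br : V -> V -> V)
  (n : nat) :
  is_lie br -> nilpotent br -> #|F| <> 2%N ->
  dim_gt (derived br) (n * (n - 1) %/ 2) ->
  forall H : 'I_(#|F| - 1) -> (V -> Prop),
    (forall i, proper_subalgebra br (H i)) ->
    exists x : V, breadth_ge br x n /\ forall i, ~ H i x.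
Proof.
move=> lie_br nil_br F_neq2 [v [v_der v_free]] H H_proper.
have F_gt2 : (2 < #|F|)%N.
  by rewrite ltn_neqAle eq_sym card_finNzRing_gt1 andbT; apply/eqP.
have /fin_all_exists[s sP] i := derived_sum lie_br (v_der i).
have /fin_all_exists[h hP] i := (H_proper i).2.
(* The vectors [h i] outside [H i] keep the traces of the [H i] proper in the model; the entries of
   the brackets that sum to [v i] keep its derived algebra large. *)
pose gens := codom h ++ flatten
  [seq unzip1 (s i) ++ unzip2 (s i) | i <- enum 'I_(n * (n - 1) %/ 2).+1].
have [T [psi [ad [psi_inj psi_ad gensP]]]] :=
  finite_dim_model lie_br gens nil_br.
have lie_ad := model_is_lie lie_br psi_inj psi_ad.
have /fin_all_exists[A AP] i :
    exists A : {vspace T}, forall u, u \in A <-> H i (psi u).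
  have [[H0 HD HZ _] _] := H_proper i; apply: vspace_of_pred => [|u w|a u].
  - by rewrite linear0.
  - by rewrite linearD; apply: HD.
  - by rewrite linearZ; apply: HZ.
have [c nil_c] := nil_br.
have Dc : lower_central ad c = 0%VS.
  apply/eqP; rewrite -subv0; apply/subvP => u uc; rewrite memv0; apply/eqP.
  by apply: psi_inj; rewrite linear0; apply/nil_c/(lower_central_lcs psi_ad).
have DS k x y : y \in lower_central ad k -> ad x y \in lower_central ad k.+1.
  by move=> yk; apply: mem_brv; rewrite ?memvf.
have /fin_all_exists[u uP] i : exists u, u \in brv ad fullv fullv /\ psi u = v i.
  have [|u uD us] := model_derived lie_br psi_inj psi_ad (s := s i); last first.
    by exists u; rewrite us -sP.
  move=> p ps; have gens_i x : x \in unzip1 (s i) ++ unzip2 (s i) -> x \in gens.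
    move=> xs; rewrite mem_cat; apply/orP; right.
    apply/flattenP; exists (unzip1 (s i) ++ unzip2 (s i)) => //.
    exact/map_f/mem_enum.
  by split; apply/gensP/gens_i; rewrite mem_cat map_f ?orbT.
have [||||x _ [bx xA]] := large_breadth_avoiding lie_ad (erefl _) Dc DS F_gt2
  (L := fullv) (n := n) (Hs := codom A).
- exact: subvf.
- apply: (model_dim (psi := psi) (u := u)) => [i|a]; first by case: (uP i).
  move=> a0; apply: v_free; rewrite -[RHS]a0.
  by apply: eq_bigr => i _; rewrite (uP i).2.
- by rewrite size_codom card_ord subn1 prednK // ltnW // ltnW.
- move=> _ /codomP[i ->]; rewrite subvf; split=> //.
    apply: brv_subP => // x y /AP Hx /AP Hy; apply/AP; rewrite psi_ad.
    by have [[_ _ _ HB] _] := H_proper i; apply: HB.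
  have [|w wh] := gensP (h i); first by rewrite mem_cat codom_f.
  by apply/negP => /subvP/(_ w (memvf w))/AP; rewrite wh; apply: hP.
exists (psi x); split; first exact: (model_breadth psi_inj psi_ad).
by move=> i /AP; apply/negP/xA/codom_f.
Qed.
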